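(* Let $G=G(\mathcal P,E(\mathcal P))$ be the weighted digraph associated with a discrete-time switched linear system (with vertex weights $w(j)=|\ln\lambda_j|$ and edge weights $w(i,j)=\ln\mu_{ij}$, as described in the context). The following are equivalent: (i) $G$ admits a closed contractive walk; (ii) $G$ admits a closed contractive circuit (i.e. a circuit that is contractive); (iii) $G$ admits a closed contractive cycle (i.e. a cycle that is contractive). Consequently, if $W_0$ is a walk on $G$ as in one of (i), (ii), (iii), then the infinite walk $W$ obtained by repeating $W_0$ indefinitely satisfies $$\limsup_{\substack{|W'|\to+\infty\\ W'\le W}}\Xi(W')<1,$$ where $W'\le W$ means that $W'$ is an initial subwalk of $W$.
   Context: **Switched system.** $\mathcal P=\{1,\dots,N\}$ is a finite index set, and for each $i\in\mathcal P$, $A_i\in\mathbb R^{d\times d}$ is a full-rank matrix defining the subsystem $x(t+1)=A_ix(t)$, $t\in\mathbb N_0$. A switched system is $x(t+1)=A_{\sigma(t)}x(t)$ with switching signal $\sigma:\mathbb N_0\to\mathcal P$. $\mathcal P_S$ and $\mathcal P_U$ are the sets of indices of asymptotically stable and unstable subsystems, and $\mathcal P=\mathcal P_S\sqcup\mathcal P_U$. For each $i\in\mathcal P$ a pair $(P_i,\lambda_i)$ is fixed, where $P_i\in\mathbb R^{d\times d}$ is symmetric positive definite, $0<\lambda_i<1$ if $i\in\mathcal P_S$, $\lambda_i>1$ if $i\in\mathcal P_U$, and the function $V_i(\xi)=\xi^\top P_i\xi$ satisfies $V_i(A_i\xi)\le\lambda_iV_i(\xi)$ for all $\xi\in\mathbb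 R^d$. Whenever switching from $i$ to $j$ is admissible, $\mu_{ij}>0$ is a fixed number with $V_j(\xi)\le\mu_{ij}V_i(\xi)$ for all $\xi\in\mathbb R^d$ (the smallest such number is $\lambda_{\max}(P_jP_i^{-1})$, the maximal eigenvalue). **Weighted digraph.** $G(\mathcal P,E(\mathcal P))$ has vertex set $\mathcal P$. It has an edge $(i,j)$ whenever switching from $i$ to $j$ is admissible (given data), including a self-loop $(j,j)$ whenever it is admissible to dwell on $j$ for at least two consecutive time steps. Edge weights are $w(i,j)=\ln\mu_{ij}$ and vertex weights are $w(j)=|\ln\lambda_j|$. **Walks.** A walk is an alternating sequence $W=x_0,e_1,x_1,\dots,e_\ell,x_\ell$ of vertices and edges with $e_i=(x_{i-1},x_i)\in E(\mathcal P)$. Its length $|W|=\ell$ is its number of edges counted with repetition. It is closed if $x_0=x_\ell$ (closed walks, circuits and cycles have length at least $1$). A circuit is a closed walk all of whose edges are distinct. A cycle is a closed walk in which the vertices $x_i$, $0<i<\ell$, are distinct from each other and from $x_0$. An infinite walk has infinitely many edges. An initial subwalk $W'\le W$ is an initial segment of $W$. **The function $\Xi$.** For a finite walk $W$, let $\sharp\{k\to\ell\}_W$ and $\sharp\{j\}_W$ be the number of times the edge $(k,\ell)$ and the vertex $j$ appear in $W$, and set $$\Xi(W)=\frac{\sum_{(k,\ell)\in E(\mathcal P)}w(k,\ell)\,\sharp\{k\to\ell\}_W+\sum_{j\in\mathcal P_U}w(j)\,\sharp\{j\}_W}{\sum_{j\in\mathcal P_S}w(j)\,\sharp\{j\}_W}.$$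 **Contractivity.** A walk $W$ is contractive if $\Xi(W)<1$. For closed walks, the convention is that $\sharp\{j\}_W$ is taken to be $\sum_{(j,\ell)\in E(\mathcal P)}\sharp\{j\to\ell\}_W$. With this convention, contractivity of a closed walk $W$ means $$\overline\Xi(W):=\sum_{(k,\ell)\in E(\mathcal P)}\bigl(w(k,\ell)+w(k)1_{\mathcal P_U}(k)-w(k)1_{\mathcal P_S}(k)\bigr)\,\sharp\{k\to\ell\}_W<0.$$ *)

(* Defs.v *)
From HB Require Import structures.
From mathcomp Require Import all_boot all_order all_algebra.
From mathcomp Require Import boolp classical_sets reals constructive_ereal.
From mathcomp Require Import topology normedtype sequences exp.

Set Implicit Arguments.
Unset Strict Implicit.
Unset Printing Implicit Defensive.

Import Order.TTheory GRing.Theory Num.Theory.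
Import numFieldNormedType.Exports.

Local Open Scope ring_scope.

Section Stability.
Context {R : realType} {d : nat}.
Implicit Types (A P : 'M[R]_d) (x : 'cV[R]_d).

Definition trajectory A x (t : nat) : 'cV[R]_d := iter t (mulmx A) x.

Definition lyapunov_stable A :=
  forall e : R, 0 < e -> exists2 r : R, 0 < r &
    forall x, `|x| < r -> forall t, `|trajectory A x t| < e.

Definition asymptotically_stable A :=
  lyapunov_stable A /\ forall x, (trajectory A x @ \oo --> (0 : 'cV[R]_d))%classic.

Definition unstable A := ~ lyapunov_stable A.

Definition quad P x : R := (x^T *m P *m x) ord0 ord0.

Definition sym_posdef P := P^T = P /\ forall x, x != 0 -> 0 < quad P x.

End Stability.

Definition stable_indices (R : realType) (d N : nat) (A : 'I_N -> 'M[R]_d) :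
  {set 'I_N} := [set i | `[< asymptotically_stable (A i) >]]%SET.

Definition unstable_indices (R : realType) (d N : nat) (A : 'I_N -> 'M[R]_d) :
  {set 'I_N} := [set i | `[< unstable (A i) >]]%SET.

(* The admissible switches [adm] are the edges of the digraph; the values of
   [mu] outside [adm] are irrelevant. *)
Record switched_system (R : realType) (d N : nat) := SwitchedSystem {
  sysA : 'I_N -> 'M[R]_d;
  adm : rel 'I_N;
  lyapP : 'I_N -> 'M[R]_d;
  lam : 'I_N -> R;
  mu : 'I_N -> 'I_N -> R;
  dim_gt0 : (0 < d)%N;
  sysA_full_rank : forall i, \rank (sysA i) = d;
  stable_or_unstable :
    stable_indices sysA :|: unstable_indices sysA = [set: 'I_N];
  stable_unstable_disjoint :
    [disjoint stable_indices sysA & unstable_indices sysA];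
  lyapP_posdef : forall i, sym_posdef (lyapP i);
  lam_stable : forall i, i \in stable_indices sysA -> 0 < lam i < 1;
  lam_unstable : forall i, i \in unstable_indices sysA -> 1 < lam i;
  lam_decay : forall i x,
    quad (lyapP i) (sysA i *m x) <= lam i * quad (lyapP i) x;
  mu_gt0 : forall i j, adm i j -> 0 < mu i j;
  mu_switch : forall i j, adm i j ->
    forall x, quad (lyapP j) x <= mu i j * quad (lyapP i) x
}.

Section Walks.
Context {V : finType}.
Implicit Types (E : rel V) (W : V * seq V) (w : nat -> V).

(* The pair (x_0, [:: x_1; ...; x_l]) encodes the walk x_0, e_1, x_1, ..., x_l:
   the edges are determined by the vertices since edges are pairs. *)
Definition walk E W := path E W.1 W.2.

Definition wlength W := size W.2.

Definition wvertices W : seq V := W.1 :: W.2.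

Definition wedges W : seq (V * V) := zip (W.1 :: W.2) W.2.

Definition is_closed W := (0 < wlength W)%N && (last W.1 W.2 == W.1).

Definition closed_walk E W := walk E W && is_closed W.

Definition circuit E W := closed_walk E W && uniq (wedges W).

(* [belast W.1 W.2] lists x_0, ..., x_(l-1). *)
Definition cycle_walk E W := closed_walk E W && uniq (belast W.1 W.2).

Definition infinite_walk E w := forall t, E (w t) (w t.+1).

Definition initial_subwalk w (n : nat) : V * seq V :=
  (w 0%N, [seq w i.+1 | i <- iota 0 n]).

Definition repeat_walk W (t : nat) : V :=
  nth W.1 (wvertices W) (t %% wlength W).

Definition edge_count W (k l : V) : nat := count_mem (k, l) (wedges W).

(* On a closed walk the common end point is counted once. *)
Definition vertex_count E W (j : V) : nat :=
  if is_closed W then (\sum_(l | E j l) edge_count W j l)%N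
  else count_mem j (wvertices W).

Lemma repeat_walk_infinite E W :
  closed_walk E W -> infinite_walk E (repeat_walk W).
Proof.
case: W => x p /andP[/(pathP x) /= pE /andP[/= p_gt0 /eqP lastp]] t.
rewrite /repeat_walk /wvertices /wlength /=.
have := ltn_pmod t p_gt0; set r := (t %% size p)%N => rp.
have -> : (t.+1 %% size p = r.+1 %% size p)%N.
  by rewrite -[in RHS]addn1 modnDml addn1.
have [lt_r|] := ltnP r.+1 (size p).
  by rewrite modn_small//; exact: pE.
rewrite leq_eqVlt ltnNge rp orbF => /eqP er.
rewrite -er modnn /=; have := pE _ rp.
suff -> : nth x p r = x by [].
by rewrite -[RHS]lastp -nth_last er.
Qed.

End Walks.

Section Contractivity.
Context {R : realType} {d N : nat}.
Variable S : switched_system R d N.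
Implicit Types W : 'I_N * seq 'I_N.

Definition PS := stable_indices (sysA S).
Definition PU := unstable_indices (sysA S).

Definition vweight (j : 'I_N) : R := `|ln (lam S j)|.
Definition eweight (i j : 'I_N) : R := ln (mu S i j).

Definition Xi_num W : R :=
  \sum_(k < N) \sum_(l < N | adm S k l) eweight k l * (edge_count W k l)%:R
  + \sum_(j in PU) vweight j * (vertex_count (adm S) W j)%:R.

Definition Xi_den W : R :=
  \sum_(j in PS) vweight j * (vertex_count (adm S) W j)%:R.

(* Extended division: if no stable vertex occurs then [Xi W] is [+oo], [-oo] or
   [0] according to the sign of the numerator.  On a closed walk the numerator
   is then positive, see [contractive_closedP]. *)
Definition Xi W : \bar R := ((Xi_num W)%:E / (Xi_den W)%:E)%E.

Definition contractive W : Prop := (Xi W < 1)%E.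

Definition Xibar W : R :=
  \sum_(k < N) \sum_(l < N | adm S k l)
    (eweight k l + vweight k * (k \in PU)%:R - vweight k * (k \in PS)%:R)
    * (edge_count W k l)%:R.

Lemma sum_edge_count (f : 'I_N -> 'I_N -> R) W : walk (adm S) W ->
  \sum_(k < N) \sum_(l < N | adm S k l) f k l * (edge_count W k l)%:R =
  \sum_(e <- wedges W) f e.1 e.2.
Proof.
case: W => x p; rewrite /walk /wedges /= => pE.
have {pE} : all (fun e => adm S e.1 e.2) (zip (x :: p) p).
  by elim: p x pE => //= y p IH x /andP[-> /IH].
rewrite /edge_count /wedges /=; elim: (zip _ _) => [_|e s IH /= /andP[Ee /IH sE]].
  rewrite big_nil big1// => k _; rewrite big1// => l _.
  by rewrite mulr0.
rewrite big_cons -sE !(pair_big_dep xpredT (adm S)) /=.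
under eq_bigr do rewrite natrD mulrDr.
rewrite big_split /=; congr (_ + _).
rewrite (bigD1 e)//= -surjective_pairing eqxx mulr1 big1 ?addr0// => -[k l].
by move=> /andP[_ /=]; rewrite eq_sym => /negbTE ->; rewrite mulr0.
Qed.

Lemma sum_eweight_closed W : closed_walk (adm S) W ->
  0 <= \sum_(e <- wedges W) eweight e.1 e.2.
Proof.
pose xi : 'cV[R]_d := const_mx 1.
have xi0 : xi != 0.
  apply/eqP => /matrixP/(_ (Ordinal (dim_gt0 S)) ord0).
  by rewrite !mxE; apply/eqP; exact: oner_neq0.
have Vgt0 i : 0 < quad (lyapP S i) xi by exact: (lyapP_posdef S i).2.
case: W => x p /andP[]; rewrite /walk /wedges /= => pE /andP[_ /= /eqP lastp].
rewrite -(lerD2l (ln (quad (lyapP S x) xi))) addr0 -{1}lastp {lastp}.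
elim: p x pE => [x _|y p IH x /= /andP[Exy /IH]]; first by rewrite big_nil addr0.
move=> /le_trans; apply; rewrite big_cons addrA lerD2r /=.
rewrite addrC /eweight -lnM ?posrE ?mu_gt0 ?Vgt0//.
rewrite ler_ln ?posrE ?mulr_gt0 ?Vgt0 ?(mu_gt0 Exy)//; exact: mu_switch.
Qed.

Lemma PU_PS j : (j \in PU) = (j \notin PS).
Proof.
have /pred0P/(_ j) /= := stable_unstable_disjoint S.
have : j \in PS :|: PU by rewrite /PS /PU stable_or_unstable inE.
by rewrite inE -/PS -/PU; case: (j \in PS); case: (j \in PU).
Qed.

Lemma vweight_gt0 j : 0 < vweight j.
Proof.
have lj : 0 < lam S j /\ lam S j != 1.
  have [jS|] := boolP (j \in PS).
    by have /andP[-> /lt_eqF ->] := lam_stable jS.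
  rewrite -PU_PS => /lam_unstable l1.
  by rewrite (lt_trans ltr01 l1) gt_eqF.
by rewrite /vweight normr_gt0 ln_eq0 ?lj.1 ?lj.2.
Qed.

Lemma sum_vertex_closed W (Q : {set 'I_N}) : closed_walk (adm S) W ->
  \sum_(j in Q) vweight j * (vertex_count (adm S) W j)%:R =
  \sum_(e <- wedges W) vweight e.1 * (e.1 \in Q)%:R.
Proof.
move=> /andP[wW cW]; rewrite -(sum_edge_count (fun k _ => vweight k * (k \in Q)%:R))//.
rewrite big_mkcond /=; apply: eq_bigr => k _; rewrite /vertex_count cW.
rewrite -mulr_sumr -natr_sum; case: (k \in Q); rewrite ?mulr1//.
by rewrite mulr0 mul0r.
Qed.

Lemma contractive_closedP W : closed_walk (adm S) W ->
  contractive W <-> Xibar W < 0.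
Proof.
move=> clW; have [wW cW] := andP clW.
rewrite /contractive /Xi /Xi_num /Xi_den /Xibar sum_edge_count//.
rewrite sum_edge_count// !sum_vertex_closed//.
rewrite sumrB big_split /=.
set e := \sum_(_ <- _) eweight _ _.
set u := \sum_(_ <- _) vweight _ * (_ \in PU)%:R.
set s := \sum_(_ <- _) vweight _ * (_ \in PS)%:R.
have u0 : 0 <= u by apply: sumr_ge0 => i _; rewrite mulr_ge0 ?ler0n// ltW ?vweight_gt0.
have s0 : 0 <= s by apply: sumr_ge0 => i _; rewrite mulr_ge0 ?ler0n// ltW ?vweight_gt0.
have e0 : 0 <= e by exact: sum_eweight_closed.
have us0 : 0 < u + s.
  rewrite /u /s -big_split /= {clW wW u s e s0 u0 e0}.
  case: W cW => x [|y p] //= _; rewrite /wedges /= big_cons /=.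
  have -> : vweight x * (x \in PU)%:R + vweight x * (x \in PS)%:R = vweight x.
    by rewrite PU_PS -mulrDr; case: (x \in PS); rewrite /= ?addr0 ?add0r mulr1.
  rewrite ltr_pwDl ?vweight_gt0// sumr_ge0// => i _.
  by rewrite addr_ge0// mulr_ge0 ?ler0n// ltW ?vweight_gt0.
have [s_eq0|s_neq0] := eqVneq s 0.
  rewrite s_eq0 subr0 /inve eqxx.
  rewrite s_eq0 addr0 in us0.
  have eu : 0 < e + u by rewrite ltr_wpDl.
  rewrite gt0_muley ?lte_fin//.
  by split => //; rewrite ltNge (ltW eu).
have s_gt0 : 0 < s by rewrite lt_neqAle eq_sym s_neq0.
by rewrite inver (negbTE s_neq0) -EFinM lte_fin ltr_pdivrMr// mul1r subr_lt0.
Qed.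

End Contractivity.

(* Main.v *)
(* The weight of a closed walk is the sum of its edge costs, and a closed walk
   that visits a vertex twice splits there into two shorter closed walks whose
   costs add up; one of them is again negative, so a shortest closed walk of
   negative cost is a cycle.  For the walk repeating [W0], let [A] and [B] be
   the numerator and the denominator of [Xi] on [W0].  After [q] periods the
   numerator is at most [q A + C] and the denominator at least [q B], with [C]
   independent of the length, so the limsup is at most [A / B < 1]. *)
Require Import Defs.
From mathcomp Require Import all_boot all_order all_algebra.
From mathcomp Require Import classical_sets.
From mathcomp Require Import reals constructive_ereal ereal.
From mathcomp Require Import normedtype sequences.
From mathcomp Require Import ring lra.

Set Implicit Arguments.
Unset Strict Implicit.
Unset Printing Implicit Defensive.

Import Order.TTheory GRing.Theory Num.Theory.

Local Open Scope ring_scope.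

(** * Cutting closed walks and unrolling periodic ones *)

Section WalkLemmas.
Context {V : finType}.
Implicit Types (E : rel V) (x : V) (p : seq V) (W : V * seq V).

Lemma wedges_cat x p1 p2 :
  wedges (x, p1 ++ p2) = wedges (x, p1) ++ wedges (last x p1, p2).
Proof. by rewrite /wedges /=; elim: p1 x => //= y p1 IH x; rewrite IH. Qed.

Lemma unzip1_wedges x p : unzip1 (wedges (x, p)) = belast x p.
Proof. by rewrite /wedges /=; elim: p x => //= y p IH x; rewrite IH. Qed.

(** The sources of the edges are the vertices in [belast], and edges with distinct sources are
    distinct. *)
Lemma cycle_circuit E W : cycle_walk E W -> circuit E W.
Proof.
case: W => x p /andP[clW /= uW]; rewrite /circuit clW /=.
by rewrite -unzip1_wedges in uW; exact: map_uniq uW.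
Qed.

(** If positions [i < j] carry the same vertex, the segment between them is the closed walk [p2],
    and skipping it leaves a closed walk. As [belast] omits the end point, [j < size p], so [p3] is
    nonempty and both pieces are shorter than [p]. *)
Lemma closed_walk_split E x p :
  closed_walk E (x, p) -> ~~ uniq (belast x p) ->
  exists p1 p2 p3,
    [/\ p = p1 ++ p2 ++ p3, closed_walk E (last x p1, p2),
       closed_walk E (x, p1 ++ p3), (0 < size p2)%N & (0 < size p3)%N].
Proof.
move=> /andP[pE /andP[/= _ /eqP lastp]].
move=> /(uniqPn x)[i [j [lt_ij]]]; rewrite size_belast => lt_jp.
have lastE k : (k < size p)%N -> nth x (belast x p) k = last x (take k p).
  elim: p x k {pE lastp lt_jp} => // y p IH x [|k] //= ltk.
  rewrite -IH//; apply: set_nth_default; by rewrite size_belast.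
have lt_ip := ltn_trans lt_ij lt_jp.
rewrite !lastE// => eq_last.
have e1 : take j p = take i p ++ drop i (take j p).
  by rewrite -{1}(cat_take_drop i (take j p)) take_takel// ltnW.
have [p1 [p2 [p3 [ep p12 s2 s3]]]] : exists p1 p2 p3,
    [/\ p = p1 ++ p2 ++ p3, last x p1 = last (last x p1) p2,
       (0 < size p2)%N & (0 < size p3)%N].
  exists (take i p), (drop i (take j p)), (drop j p); split.
  - by rewrite catA -e1 cat_take_drop.
  - by rewrite -last_cat -e1.
  - by rewrite size_drop size_takel ?subn_gt0// ltnW.
  - by rewrite size_drop subn_gt0.
exists p1, p2, p3; move: pE lastp.
rewrite ep /closed_walk /is_closed /walk /wlength /= !cat_path !last_cat -p12.
move=> /and3P[p1E p2E p3E] ->.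
by rewrite p1E p2E p3E s2 !eqxx size_cat addn_gt0 s3 orbT.
Qed.

Lemma negative_cycle (R : realDomainType) E (c : V * V -> R) W :
  closed_walk E W -> \sum_(e <- wedges W) c e < 0 ->
  exists2 W', cycle_walk E W' & \sum_(e <- wedges W') c e < 0.
Proof.
have [n] := ubnP (wlength W); elim: n W => // n IH [x p] ltn clW negW.
have [uW|] := boolP (uniq (belast x p)).
  by exists (x, p) => //; rewrite /cycle_walk clW.
move=> /(closed_walk_split clW)[p1 [p2 [p3 [ep cl2 cl13 s2 s3]]]].
move: ltn negW; rewrite /wlength ep /= !size_cat ltnS => ltn.
rewrite !wedges_cat !big_cat /= => negW.
have [neg2|pos2] := ltP (\sum_(e <- wedges (last x p1, p2)) c e) 0.
  apply: IH cl2 neg2; rewrite /wlength /=.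
  by apply: leq_trans ltn; rewrite addnCA -addn1 leq_add2l addn_gt0 s3 orbT.
apply: (IH _ _ cl13).
  rewrite /wlength /= size_cat; apply: leq_trans ltn.
  by rewrite ltn_add2l -{1}(add0n (size p3)) ltn_add2r.
(* Since [p2] returns to its starting vertex, [p3] has the same edges after [p1] as after
   [p1 ++ p2]; removing a loop of nonnegative cost keeps the total negative. *)
have [_ /andP[_ /eqP /= last2]] := andP cl2.
rewrite wedges_cat big_cat /=.
by move: negW pos2; rewrite last2; lra.
Qed.

Lemma wedges_initial_subwalk (w : nat -> V) n :
  wedges (initial_subwalk w n) = [seq (w i, w i.+1) | i <- iota 0 n].
Proof.
rewrite /wedges /initial_subwalk /=; elim: n 0%N => //= n IH m.
by rewrite IH.
Qed.

Lemma wvertices_initial_subwalk (w : nat -> V) n :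
  wvertices (initial_subwalk w n) = [seq w i | i <- iota 0 n.+1].
Proof. by rewrite /wvertices /= -[1%N]addn0 iotaDl -map_comp. Qed.

Lemma walk_initial_subwalk E (w : nat -> V) n :
  infinite_walk E w -> walk E (initial_subwalk w n).
Proof.
move=> wE; rewrite /walk /initial_subwalk /=.
by elim: n 0%N => //= n IH m; rewrite wE IH.
Qed.

Lemma initial_repeat_walk W :
  is_closed W -> initial_subwalk (repeat_walk W) (wlength W) = W.
Proof.
case: W => x p /andP[]; rewrite /wlength /= => p_gt0 /eqP lastp.
rewrite /initial_subwalk {1}/repeat_walk mod0n /=; congr pair.
apply: (@eq_from_nth _ x); rewrite size_map size_iota// => i lt_ip.
rewrite (nth_map 0%N) ?size_iota// nth_iota// add0n.
rewrite /repeat_walk /wvertices /wlength /=.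
have [lt_i|] := ltnP i.+1 (size p); first by rewrite modn_small.
(* At the last position the index wraps to 0, and closedness identifies the vertex there with
   [x]. *)
rewrite leq_eqVlt ltnNge lt_ip orbF => /eqP ei.
by rewrite -ei modnn /= -{1}lastp -nth_last ei.
Qed.

Lemma repeat_walk_periodic W t :
  repeat_walk W (wlength W + t) = repeat_walk W t.
Proof. by rewrite /repeat_walk modnDl. Qed.

Lemma sum_count_mem (R : pzSemiRingType) (f : V -> R) (s : seq V) :
  \sum_j f j * (count_mem j s)%:R = \sum_(j <- s) f j.
Proof.
elim: s => [|x s IH] /=.
  by rewrite big_nil big1// => j _; rewrite mulr0.
rewrite big_cons -IH; under eq_bigr do rewrite natrD mulrDr.
rewrite big_split /=; congr (_ + _); rewrite (bigD1 x)//= eqxx mulr1.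
by rewrite big1 ?addr0// => j; rewrite eq_sym => /negbTE ->; rewrite mulr0.
Qed.

End WalkLemmas.

(** * Periodic sums and upper limits *)

Lemma sum_periodic (M : nmodType) (a : nat -> M) L q r :
  (forall t, a (L + t)%N = a t) ->
  \sum_(0 <= i < q * L + r) a i =
    (\sum_(0 <= i < L) a i) *+ q + \sum_(0 <= i < r) a i.
Proof.
move=> aL; elim: q => [|q IH]; first by rewrite mul0n add0n mulr0n add0r.
rewrite mulSn -addnA (big_cat_nat (n := L)) ?leq_addr//= mulrS -addrA -IH.
congr (_ + _); rewrite -{1}(add0n L) big_addn addKn.
by apply: eq_bigr => i _; rewrite addnC aL.
Qed.

(** The upper limit is an infimum of suprema over the neighbourhoods of infinity, and the tail from
    [n0] is one of these. *)
Lemma limn_esup_le (R : realType) (u : (\bar R)^nat) (l : \bar R) n0 :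
  (forall n, (n0 <= n)%N -> (u n <= l)%E) -> (limn_esup u <= l)%E.
Proof.
move=> ul; rewrite /limn_esup /limf_esup.
apply: (@le_trans _ _ (ereal_sup (u @` [set n | (n0 <= n)%N]%classic))).
  apply: ereal_inf_lbound; exists [set n | (n0 <= n)%N]%classic => //.
  by exists n0.
by apply: ge_ereal_sup => _ [n /= /ul ? <-].
Qed.

(** * Contractive cycles and the repeated walk *)

Section Switched.
Context {R : realType} {d N : nat}.
Variable S : switched_system R d N.

(** Each vertex weight is charged to the outgoing edge, which makes the criterion additive under
    cutting, unlike the quotient [Xi]. *)
Definition edge_cost (e : 'I_N * 'I_N) : R :=
  eweight S e.1 e.2 + vweight S e.1 * (e.1 \in PU S)%:R
  - vweight S e.1 * (e.1 \in PS S)%:R.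

Lemma Xibar_edge_cost W :
  walk (adm S) W -> Xibar S W = \sum_(e <- wedges W) edge_cost e.
Proof. by move=> wW; rewrite /Xibar sum_edge_count. Qed.

Lemma contractive_cycle W :
  closed_walk (adm S) W -> contractive S W ->
  exists W', cycle_walk (adm S) W' /\ contractive S W'.
Proof.
move=> clW /(contractive_closedP clW); rewrite Xibar_edge_cost; last first.
  by case/andP: clW.
move=> /(negative_cycle clW)[W' cyW' negW']; exists W'; split => //.
have [clW' _] := andP cyW'.
apply/(contractive_closedP clW'); rewrite Xibar_edge_cost//.
by case/andP: clW'.
Qed.

Definition weight_in (Q : {set 'I_N}) (j : 'I_N) : R :=
  vweight S j * (j \in Q)%:R.

Lemma weight_in_ge0 Q j : 0 <= weight_in Q j.
Proof. by rewrite mulr_ge0 ?ler0n// ltW ?vweight_gt0. Qed.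

(* The end point is counted when the subwalk is not closed, and omitted by the
   convention on closed walks otherwise. *)
Lemma sum_vertex_initial_subwalk (Q : {set 'I_N}) (w : nat -> 'I_N) n :
  infinite_walk (adm S) w ->
  \sum_(0 <= i < n) weight_in Q (w i) <=
    \sum_(j in Q) vweight S j *
      (vertex_count (adm S) (initial_subwalk w n) j)%:R <=
  \sum_(0 <= i < n) weight_in Q (w i) + weight_in Q (w n).
Proof.
move=> wE; set W := initial_subwalk w n.
have wW : walk (adm S) W by exact: walk_initial_subwalk.
have [cW|ncW] := boolP (is_closed W).
  rewrite sum_vertex_closed ?/closed_walk ?wW//.
  rewrite wedges_initial_subwalk big_map /index_iota subn0.
  by rewrite lexx lerDl weight_in_ge0.
have -> : \sum_(j in Q) vweight S j * (vertex_count (adm S) W j)%:R =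
    \sum_j weight_in Q j * (count_mem j (wvertices W))%:R.
  rewrite big_mkcond; apply: eq_bigr => j _.
  rewrite /vertex_count (negbTE ncW) /weight_in.
  by case: (j \in Q); rewrite ?mulr1// mulr0 mul0r.
rewrite sum_count_mem wvertices_initial_subwalk big_map.
rewrite -[iota 0 n.+1]/(index_iota 0 n.+1) big_nat_recr//=.
by rewrite lexx lerDl weight_in_ge0.
Qed.

Lemma limn_esup_repeat W0 :
  closed_walk (adm S) W0 -> contractive S W0 ->
  (limn_esup (fun n => Xi S (initial_subwalk (repeat_walk W0) n)) < 1)%E.
Proof.
move=> clW /(contractive_closedP clW) negW.
have [wW cW] := andP clW; have [L_gt0 _] := andP cW.
set w := repeat_walk W0; set L := wlength W0 in L_gt0 *.
have wE : infinite_walk (adm S) w by exact: repeat_walk_infinite.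
have W0E : wedges W0 = [seq (w i, w i.+1) | i <- index_iota 0 L].
  by rewrite -{1}(initial_repeat_walk cW) wedges_initial_subwalk /index_iota subn0.
pose e i := eweight S (w i) (w i.+1).
pose a i := e i + weight_in (PU S) (w i).
pose b i := weight_in (PS S) (w i).
have aL t : a (L + t)%N = a t by rewrite /a /e -addnS /w !repeat_walk_periodic.
have bL t : b (L + t)%N = b t by rewrite /b /w repeat_walk_periodic.
pose A := \sum_(0 <= i < L) a i; pose B := \sum_(0 <= i < L) b i.
(* Switching around a closed walk returns to the initial Lyapunov function, so the logarithms of
   [mu] sum to at least 0. This yields [B > 0] below. *)
have A_ge0 : 0 <= A.
  rewrite /A big_split addr_ge0//=.
    by have := sum_eweight_closed clW; rewrite W0E big_map.
  by apply: sumr_ge0 => i _; exact: weight_in_ge0.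
have ltAB : A < B.
  move: negW; rewrite Xibar_edge_cost// W0E big_map /edge_cost /=.
  by rewrite sumrB subr_lt0.
have B_gt0 : 0 < B by exact: le_lt_trans ltAB.
(* The first sum bounds any incomplete period, where terms [a i] may be negative; the second bounds
   the weight of the end vertex. *)
pose C := \sum_(0 <= i < L) `|a i| + \sum_j weight_in (PU S) j.
have [q0 ltq0] : exists q0 : nat, 2 * C / (B - A) < q0%:R.
  by eexists; exact: truncnS_gt.
(* The midpoint of [A / B] and 1: the slack [(B - A) / 2] gained per period exceeds [C] in total
   after more than [q0] periods. *)
pose r := (A + B) / (2 * B).
apply: (@le_lt_trans _ _ r%:E); last first.
  rewrite lte_fin ltr_pdivrMr ?mulr_gt0// mul1r; lra.
apply: (@limn_esup_le _ _ _ (q0.+1 * L)) => n le_n.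
set q := (n %/ L)%N.
have ltq : (q0 < q)%N by rewrite /q leq_divRL.
have numE : Xi_num S (initial_subwalk w n) <= A * q%:R + C.
  rewrite /Xi_num sum_edge_count; last exact: walk_initial_subwalk.
  rewrite wedges_initial_subwalk big_map -{1}(subn0 n) -/(index_iota 0 n) /=.
  have /andP[_] := sum_vertex_initial_subwalk (PU S) n wE.
  rewrite -(lerD2l (\sum_(0 <= i < n) e i)) => /le_trans; apply.
  rewrite addrA -big_split /= -/(a _) (divn_eq n L) -/q.
  rewrite sum_periodic// -/A mulr_natr -addrA lerD2l lerD//.
    apply: (@le_trans _ _ (\sum_(0 <= i < n %% L) `|a i|)).
      by apply: ler_sum => i _; exact: ler_norm.
    rewrite [leRHS](big_cat_nat (n := n %% L))//=; last exact/ltnW/ltn_pmod.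
    by rewrite lerDl sumr_ge0.
  rewrite (bigD1 (w (q * L + n %% L)%N))//= lerDl.
  by apply: sumr_ge0 => j _; exact: weight_in_ge0.
have denE : B * q%:R <= Xi_den S (initial_subwalk w n).
  have /andP[+ _] := sum_vertex_initial_subwalk (PS S) n wE.
  apply: le_trans; rewrite [in leRHS](divn_eq n L) -/q.
  rewrite (sum_periodic _ _ bL) -/B mulr_natr lerDl.
  by apply: sumr_ge0 => i _; exact: weight_in_ge0.
have q_gt0 : 0 < q%:R :> R by rewrite ltr0n; exact: leq_ltn_trans ltq.
have den_gt0 : 0 < Xi_den S (initial_subwalk w n).
  by apply: lt_le_trans denE; rewrite mulr_gt0.
(* A positive denominator turns the extended quotient into a real one. *)
rewrite /Xi inver gt_eqF// -EFinM lee_fin ler_pdivrMr//.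
apply: (le_trans numE).
have r_ge0 : 0 <= r by rewrite divr_ge0 ?addr_ge0 ?mulr_ge0 ?(ltW B_gt0).
apply: (@le_trans _ _ (r * (B * q%:R))); last exact: ler_wpM2l.
have -> : r * (B * q%:R) = (A + B) / 2 * q%:R.
  by rewrite /r; field; rewrite gt_eqF.
have : 2 * C < q%:R * (B - A).
  rewrite -ltr_pdivrMr ?subr_gt0//; apply: lt_trans ltq0 _.
  by rewrite ltr_nat.
by lra.
Qed.

End Switched.

Theorem theorem11 (R : realType) (d N : nat) (S : switched_system R d N) :
  ((exists W, closed_walk (adm S) W /\ contractive S W) <->
   (exists W, circuit (adm S) W /\ contractive S W)) /\
  ((exists W, circuit (adm S) W /\ contractive S W) <->
   (exists W, cycle_walk (adm S) W /\ contractive S W)) /\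
  (forall W0,
     (closed_walk (adm S) W0 /\ contractive S W0) \/
     (circuit (adm S) W0 /\ contractive S W0) \/
     (cycle_walk (adm S) W0 /\ contractive S W0) ->
     (limn_esup (fun n => Xi S (initial_subwalk (repeat_walk W0) n)) < 1)%E).
Proof.
have circuit_closed W : circuit (adm S) W -> closed_walk (adm S) W.
  by case/andP.
have cycle_closed W : cycle_walk (adm S) W -> closed_walk (adm S) W.
  by case/andP.
split; [split|split; [split|]].
(* The circuit is obtained as a cycle directly. *)
- move=> [W [clW cW]]; have [W' [cyW' cW']] := contractive_cycle clW cW.
  by exists W'; split => //; exact: cycle_circuit.
- by move=> [W [/circuit_closed]]; exists W.
- by move=> [W [/circuit_closed clW cW]]; exact: contractive_cycle clW cW.
- by move=> [W [/cycle_circuit]]; exists W.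
- move=> W0 [[clW cW]|[[/circuit_closed clW cW]|[/cycle_closed clW cW]]];
    exact: limn_esup_repeat.
Qed.
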